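(* Let $R$ be a commutative ring with identity $1\neq 0$ and let $n\ge 2$ be an integer. Then $\mathrm{gr}(\overline{\mathrm{APOG}}(M_{n}(R)))=3$.
   Context: $M_n(R)$ is the ring of $n\times n$ matrices over $R$. For a ring $T$ with identity, $\mathrm{IPO}(T)$ is the set of all $A\subseteq T$ of the form $A=IJ$ where each of $I,J$ is a left or a right ideal of $T$; the product of additive subgroups is the set of finite sums of products. $\overline{\mathrm{APOG}}(T)$ is the undirected graph whose vertices are the nonzero $A\in\mathrm{IPO}(T)$ for which there is a nonzero $B\in\mathrm{IPO}(T)$ with $AB=0$ or $BA=0$; two distinct vertices $A,B$ are adjacent iff $AB=0$ or $BA=0$. $\mathrm{gr}$ denotes the girth, i.e. the length of a shortest cycle ($\infty$ if there is no cycle). *)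

(* Defs.v *)
From mathcomp Require Import all_boot all_order all_algebra.
From mathcomp Require Import boolp classical_sets constructive_ereal.

Set Implicit Arguments.
Unset Strict Implicit.
Unset Printing Implicit Defensive.

Import GRing.Theory.
Local Open Scope classical_set_scope.
Local Open Scope ring_scope.

Section IPO.
Variable T : pzRingType.
Implicit Types I J A B : set T.

Definition add_subgroup I : Prop :=
  I 0 /\ (forall x y, I x -> I y -> I (x - y)).

Definition left_ideal I : Prop :=
  add_subgroup I /\ (forall a x, I x -> I (a * x)).

Definition right_ideal I : Prop :=
  add_subgroup I /\ (forall a x, I x -> I (x * a)).

Definition one_sided_ideal I : Prop := left_ideal I \/ right_ideal I.

Definition prod_subgroup A B : set T :=
  [set x | exists (k : nat) (a b : 'I_k -> T),
     (forall i, A (a i) /\ B (b i)) /\ x = \sum_(i < k) a i * b i].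

Definition IPO : set (set T) :=
  [set A | exists I J, [/\ one_sided_ideal I, one_sided_ideal J &
                          A = prod_subgroup I J]].

Definition zero_product A B : Prop :=
  prod_subgroup A B = [set 0] \/ prod_subgroup B A = [set 0].

Definition APOG_vertex : set (set T) :=
  [set A | [/\ IPO A, A <> [set 0] &
              exists B, [/\ IPO B, B <> [set 0] & zero_product A B]]].

(* A graph is given by its type of vertices, here the set [APOG_vertex]
   coerced to a type, and its adjacency relation. *)
Definition APOG : rel APOG_vertex :=
  fun U W => `[< U <> W /\ zero_product (val U) (val W) >].

End IPO.

Section Girth.
Variables (V : eqType) (e : rel V).

(* The bound [3 <= k] is needed: [ucycle] accepts the empty cycle and, for a
   symmetric [e], the closed walk of length 2 along a single edge. *)
Definition has_cycle_of_length (k : nat) : Prop :=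
  (3 <= k)%N /\ exists c : seq V, size c = k /\ ucycle e c.

Definition girth : \bar nat :=
  match pselect (exists k, `[< has_cycle_of_length k >]) with
  | left ex_cycle => (ex_minn ex_cycle)%:E
  | right _ => +oo%E
  end.

End Girth.

(* Main.v *)
Require Import Defs.
From mathcomp Require Import all_boot all_order all_algebra.
From mathcomp Require Import boolp classical_sets constructive_ereal.

(** The girth is at least 3 by definition, so one triangle is enough, and
    Peirce corners supply it.  For idempotents [e] and [f] of a ring [T], the
    corner [eTf] is the product of the right ideal [eT] by the left ideal [Tf]
    ([IPO_corner]), so it belongs to IPO(T) although it is in general neither
    a left nor a right ideal.  Two corners [eTf] and [gTh] multiply to zero as
    soon as [fg = 0] ([prod_corner0]).  If [e] and [f] are orthogonal, then
      [eTf . eTe = 0],   [eTe . fTf = 0]   and   [fTf . eTf = 0],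
    so [eTf], [eTe], [fTf] are pairwise adjacent once they are known to be
    nonzero and distinct.  They are distinct because any two of them differ by
    an orthogonal idempotent on the left or on the right ([corner_neql],
    [corner_neqr]), and all are nonzero as soon as [eTf] is
    ([girth_APOG_orthogonal_idempotents]).  In a matrix ring of size at least
    2 over a nonzero ring, the matrix units [E_00] and [E_11] are such
    idempotents: the corner between them contains [E_01], which is nonzero. *)

Set Implicit Arguments.
Unset Strict Implicit.
Unset Printing Implicit Defensive.

Import GRing.Theory.
Local Open Scope classical_set_scope.
Local Open Scope ring_scope.

Lemma girth_triangle (V : eqType) (e : rel V) (u v w : V) :
  e u v -> e v w -> e w u -> uniq [:: u; v; w] -> girth e = (3%N)%:E.
Proof.
move=> euv evw ewu uniq_uvw.
have cycle3 : has_cycle_of_length e 3.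
  by split=> //; exists [:: u; v; w]; rewrite /ucycle uniq_uvw /= euv evw ewu.
rewrite /girth; case: pselect => [ex_cycle|no_cycle]; last first.
  by case: no_cycle; exists 3%N; apply/asboolP.
case: ex_minnP => m /asboolP[m_ge3 _] m_min; congr (_%:E).
by apply/eqP; rewrite eqn_leq m_ge3 andbT; apply/m_min/asboolP.
Qed.

Section Corner.
Variable T : pzRingType.
Implicit Types e f g h : T.

Definition corner e f : set T := [set x | exists y, x = e * y * f].

(** [eTf] is the product [(eT)(Tf)]: a sum of terms [(e a)(b f)] collapses to
    [e (sum a b) f], and conversely [e y f] is the single term [(e y)(1 f)]. *)
Lemma IPO_corner e f : IPO (corner e f).
Proof.
exists [set x | exists y, x = e * y], [set x | exists y, x = y * f]; split.
- right; split=> [|a _ [y ->]]; last by exists (y * a); rewrite mulrA.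
  split; first by exists 0; rewrite mulr0.
  by move=> _ _ [y ->] [z ->]; exists (y - z); rewrite mulrBr.
- left; split=> [|a _ [y ->]]; last by exists (a * y); rewrite mulrA.
  split; first by exists 0; rewrite mul0r.
  by move=> _ _ [y ->] [z ->]; exists (y - z); rewrite mulrBl.
apply/seteqP; split=> x /=.
  move=> [y ->]; exists 1%N, (fun=> e * y), (fun=> f).
  split; last by rewrite big_ord1.
  by move=> _; split; [exists y | exists 1; rewrite mul1r].
move=> [k [a [b [ab_in ->]]]].
have /choice[c def_a] : forall i, exists y, a i = e * y.
  by move=> i; case: (ab_in i).
have /choice[d def_b] : forall i, exists y, b i = y * f.
  by move=> i; case: (ab_in i).
exists (\sum_(i < k) c i * d i); rewrite mulr_sumr mulr_suml.
by apply: eq_bigr => i _; rewrite def_a def_b !mulrA.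
Qed.

Lemma prod_corner0 e f g h :
  f * g = 0 -> prod_subgroup (corner e f) (corner g h) = [set 0].
Proof.
move=> fg0; apply/seteqP; split=> x /=; last first.
  move=> ->; exists 0%N, (fun=> 0), (fun=> 0).
  by split; [case | rewrite big_ord0].
move=> [k [a [b [ab_in ->]]]]; apply: big1 => i _.
have [[y ->] [z ->]] := ab_in i.
by rewrite !mulrA -(mulrA _ f) fg0 mulr0 !mul0r.
Qed.

Lemma corner_neq0 e f y : e * y * f != 0 -> corner e f <> [set 0].
Proof.
move=> /eqP eyf0 ef0; apply: eyf0.
suff : [set 0] (e * y * f) by [].
by rewrite -ef0; exists y.
Qed.

(** Left multiplication by [e] is the identity on [eTf] and kills [gTh]. *)
Lemma corner_neql e f g h :
  e * e = e -> e * g = 0 -> corner e f <> [set 0] -> corner e f <> corner g h.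
Proof.
move=> ee eg0 ef_neq0 ef_gh; apply: ef_neq0.
apply/seteqP; split=> x /=; last by move=> ->; exists 0; rewrite mulr0 mul0r.
move=> ef_x; have [z def_x] : corner g h x by rewrite -ef_gh.
have [y def_x'] := ef_x.
have <- : e * x = x by rewrite def_x' !mulrA ee.
by rewrite def_x !mulrA eg0 !mul0r.
Qed.

(** Right multiplication by [f] is the identity on [eTf] and kills [gTh]. *)
Lemma corner_neqr e f g h :
  f * f = f -> h * f = 0 -> corner e f <> [set 0] -> corner e f <> corner g h.
Proof.
move=> ff hf0 ef_neq0 ef_gh; apply: ef_neq0.
apply/seteqP; split=> x /=; last by move=> ->; exists 0; rewrite mulr0 mul0r.
move=> ef_x; have [z def_x] : corner g h x by rewrite -ef_gh.
have [y def_x'] := ef_x.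
have <- : x * f = x by rewrite def_x' -!mulrA ff.
by rewrite def_x -!mulrA hf0 !mulr0.
Qed.

(** The triangle is [eTf], [eTe], [fTf]; each of the three is a vertex because
    another one annihilates it. *)
Lemma girth_APOG_orthogonal_idempotents e f y :
    e * e = e -> f * f = f -> e * f = 0 -> f * e = 0 -> e * y * f != 0 ->
  girth (@APOG T) = (3%N)%:E.
Proof.
move=> ee ff ef0 fe0 eyf_neq0.
have e_neq0 : e * 1 * e != 0.
  by rewrite mulr1 ee; apply: contraNneq eyf_neq0 => ->; rewrite !mul0r.
have f_neq0 : f * 1 * f != 0.
  by rewrite mulr1 ff; apply: contraNneq eyf_neq0 => ->; rewrite mulr0.
have nz_ef := corner_neq0 eyf_neq0.
have nz_ee := corner_neq0 e_neq0.
have nz_ff := corner_neq0 f_neq0.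
have z_ef_ee : zero_product (corner e f) (corner e e).
  by left; apply: prod_corner0.
have z_ee_ff : zero_product (corner e e) (corner f f).
  by left; apply: prod_corner0.
have z_ff_ef : zero_product (corner f f) (corner e f).
  by left; apply: prod_corner0.
have neq_ef_ee : corner e f <> corner e e by apply: corner_neqr.
have neq_ee_ff : corner e e <> corner f f by apply: corner_neql.
have neq_ff_ef : corner f f <> corner e f by apply: corner_neql.
have v_ef : corner e f \in @APOG_vertex T.
  apply/mem_set; split=> //; first exact: IPO_corner.
  by exists (corner e e); split=> //; apply: IPO_corner.
have v_ee : corner e e \in @APOG_vertex T.
  apply/mem_set; split=> //; first exact: IPO_corner.
  by exists (corner f f); split=> //; apply: IPO_corner.
have v_ff : corner f f \in @APOG_vertex T.
  apply/mem_set; split=> //; first exact: IPO_corner.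
  by exists (corner e f); split=> //; apply: IPO_corner.
pose Vef : @APOG_vertex T := SigSub v_ef.
pose Vee : @APOG_vertex T := SigSub v_ee.
pose Vff : @APOG_vertex T := SigSub v_ff.
have Vef_ee : Vef <> Vee by move=> /(congr1 val).
have Vee_ff : Vee <> Vff by move=> /(congr1 val).
have Vff_ef : Vff <> Vef by move=> /(congr1 val).
apply: (@girth_triangle _ _ Vef Vee Vff); try exact/asboolP.
rewrite /= !inE negb_or andbT; apply/andP; split; last exact/eqP.
by apply/andP; split; apply/eqP => // /esym.
Qed.

End Corner.

Theorem proposition4p3 (R : comNzRingType) (n : nat) (hn : (2 <= n)%N) :
  girth (@APOG 'M[R]_n) = (3%N)%:E.
Proof.
pose i : 'I_n := Ordinal (ltnW hn); pose j : 'I_n := Ordinal hn.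
have i_neq_j : i != j by [].
apply: (@girth_APOG_orthogonal_idempotents _ (delta_mx i i) (delta_mx j j)
          (delta_mx i j)); rewrite -!mulmxE ?mul_delta_mx //.
- by rewrite mul_delta_mx_0.
- by rewrite mul_delta_mx_0 // eq_sym.
by apply/eqP => /matrixP/(_ i j)/eqP; rewrite !mxE !eqxx oner_eq0.
Qed.
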